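(* Let $M$ be a compact metric space and $P$ a Feller Markov kernel on $M$. Let $\mathcal{C}(M)\subset\mathcal{M}(M)$ be a convex cone of measures stable by monotone convergence. Suppose that $\mu P\in\mathcal{C}(M)$ for all $\mu\in\mathcal{C}(M)$, and that $P$ possesses an accessible weak Doeblin point with a minorizing measure $\pi\in\mathcal{C}(M)$ such that for all $\mu\in\mathcal{C}(M)$, $$\mu\ge\pi\ \Rightarrow\ \mu-\pi\in\mathcal{C}(M).$$ Then $P$ has a unique invariant probability measure $\Pi$, and $\Pi\in\mathcal{C}(M)$.
   Context: $M$ carries its Borel $\sigma$-field $\mathcal{B}(M)$; $\mathcal{M}(M)$ is the set of nonnegative finite Borel measures on $M$. A convex cone of measures is a set $\mathcal{C}(M)\subset\mathcal{M}(M)$ such that $\alpha\mu+\beta\nu\in\mathcal{C}(M)$ for all $\mu,\nu\in\mathcal{C}(M)$, $\alpha,\beta\ge 0$. It is stable by monotone convergence if for every sequence $(\mu_n)_{n\ge0}$ in $\mathcal{C}(M)$ with $\mu_n\le\mu_{n+1}$ for all $n$ and such that the setwise limit $\mu(A)=\lim_n\mu_n(A)$, $A\in\mathcal{B}(M)$, is a finite measure, one has $\mu\in\mathcal{C}(M)$. A Markov kernel $P$ is Feller if $f\mapsto Pf(x)=\int f(y)P(x,dy)$ maps $C^0(M)$ into itself; $\mu P(A)=\int\mu(dx)P(x,A)$. For $0<a<1$ the $a$-resolvent is $R_a=(1-a)\sum_{k\ge0}a^kP^k$. A point $p\in M$ is accessible (for $P$) if for every neighbourhood $U$ of $p$ and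 every $x\in M$, $R_a(x,U)>0$ (for some, hence all, $0<a<1$). A point $p$ is a weak Doeblin point if there exist a neighbourhood $V$ of $p$, a non-trivial (nonzero) measure $\pi\in\mathcal{M}(M)$, and $0<a<1$ such that $R_a(x,dy)\ge\pi(dy)$ for all $x\in V$; then $\pi$ is called a minorizing measure. *)

(* Defs.v *)
From HB Require Import structures.
From mathcomp Require Import all_boot all_order all_algebra.
From mathcomp Require Import all_classical all_reals all_analysis.

Set Implicit Arguments.
Unset Strict Implicit.
Unset Printing Implicit Defensive.
Import Order.TTheory GRing.Theory Num.Theory.
Import numFieldNormedType.Exports.

Local Open Scope classical_set_scope.
Local Open Scope ring_scope.
Local Open Scope ereal_scope.

(* A measurableType is pointed, so a metric space that carries its Borel
   sigma-algebra has to be pointed (that is, nonempty); the distinguished point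
   plays no other role. *)
#[short(type="pMetricType")]
HB.structure Definition PointedMetric (R : numDomainType) :=
  {M of Metric R M & Pointed M}.

Definition borel (R : realType) (M : pMetricType R) :=
  g_sigma_algebraType (@open M).

Section kernel_action.
Context d (T : measurableType d) (R : realType).
Variables (mu : {finite_measure set T -> \bar R}) (P : R.-pker T ~> T).

(* mu P *)
Definition kact (A : set T) : \bar R := \int[mu]_x P x A.

Let kact0 : kact set0 = 0.
Proof. by rewrite /kact; apply: integral0_eq => x _; rewrite measure0. Qed.

Let kact_ge0 A : 0 <= kact A.
Proof. exact: integral_ge0. Qed.

Let kact_sigma_additive : semi_sigma_additive kact.
Proof.
move=> F mF tF mUF; rewrite [X in _ --> X](_ : _ =
  \int[mu]_x (\sum_(n <oo) P x (F n))); last first.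
  apply: eq_integral => x _.
  by apply/esym/cvg_lim => //; exact/measure_semi_sigma_additive.
apply/cvg_closeP; split.
  by apply: is_cvg_nneseries => n _ _; exact: integral_ge0.
rewrite closeE// integral_nneseries// => n.
exact: measurable_kernel.
Qed.

HB.instance Definition _ := isMeasure.Build _ _ _ kact
  kact0 kact_ge0 kact_sigma_additive.

Let kact_fin : fin_num_fun kact.
Proof.
move=> A mA; rewrite ge0_fin_numE//.
apply: (@le_lt_trans _ _ (\int[mu]__ 1)).
  apply: ge0_le_integral => //; first exact: measurable_kernel.
  by move=> x _; rewrite -(prob_kernel (s := P) x); apply: le_measure;
    rewrite ?inE.
rewrite integral_cst// mul1e -ge0_fin_numE//.
exact: fin_num_measure.
Qed.

HB.instance Definition _ := @Measure_isFinite.Build _ T R kact kact_fin.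

End kernel_action.

Section resolvent.
Context d (T : measurableType d) (R : realType).
Variable P : R.-pker T ~> T.

(* P^k(x, A) *)
Fixpoint kiter (k : nat) (x : T) (A : set T) : \bar R :=
  if k is k'.+1 then \int[P x]_y kiter k' y A else \d_x A.

Definition resolvent (a : R) (x : T) (A : set T) : \bar R :=
  (1 - a)%:E * \sum_(0 <= k <oo) (a ^+ k)%:E * kiter k x A.

Definition invariant_measure (mu : {finite_measure set T -> \bar R}) : Prop :=
  forall A, measurable A -> kact mu P A = mu A.

End resolvent.

Section markov_feller.
Context (R : realType) (M : pMetricType R).
Implicit Types (P : R.-pker (borel M) ~> (borel M)) (p : M).

Definition feller P : Prop :=
  forall f : M -> R, continuous f ->
    continuous ((fun x : M => (\int[P x]_y f y)%R) : M -> R).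

(* A neighbourhood need not be Borel, whence the measurability requirement. *)
Definition accessible P p : Prop :=
  forall U : set M, nbhs p U -> measurable (U : set (borel M)) ->
  forall x : M, exists a : R, (0 < a < 1)%R /\ 0 < resolvent P a x U.

(* p is a weak Doeblin point of P when some pi satisfies this. *)
Definition minorizing_measure P p
    (pi : {finite_measure set (borel M) -> \bar R}) : Prop :=
  pi [set: borel M] != 0 /\
  exists V a, [/\ nbhs p V, (0 < a < 1)%R &
    forall x : M, V x -> forall A : set (borel M), measurable A ->
      pi A <= resolvent P a x A].

(* Library measures are functions on all subsets, constrained only on the
   measurable ones. A set of measures must not see the values on the other
   subsets, so closure under an operation is closure under every measure with
   the prescribed values on Borel sets (a = 1, b = 0 gives invariance under
   equality on Borel sets). *)
Definition convex_cone (C : set {finite_measure set (borel M) -> \bar R})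
    : Prop :=
  forall mu nu, C mu -> C nu -> forall a b : R, (0 <= a)%R -> (0 <= b)%R ->
  forall lambda : {finite_measure set (borel M) -> \bar R},
    (forall A, measurable A -> lambda A = a%:E * mu A + b%:E * nu A) ->
    C lambda.

Definition stable_monotone_convergence
    (C : set {finite_measure set (borel M) -> \bar R}) : Prop :=
  forall (mu_ : nat -> {finite_measure set (borel M) -> \bar R})
         (mu : {finite_measure set (borel M) -> \bar R}),
    (forall n, C (mu_ n)) ->
    (forall n A, measurable A -> mu_ n A <= mu_ n.+1 A) ->
    (forall A, measurable A -> (fun n => mu_ n A) @ \oo --> mu A) ->
    C mu.

End markov_feller.

(* Main.v *)
(* Let R be the resolvent for which R(x, .) >= pi on a neighbourhood V of p.
   The Feller property and compactness turn accessibility of p into a bound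
   R(x, V) >= delta > 0 uniform in x, so the Markov kernel K = R R satisfies
   the global Doeblin condition K(x, .) >= delta pi =: pi' for every x. The map
     F mu = mu K + (1 - mu(M)) pi'
   is monotone on measures of mass at most 1, because there it equals
   mu (K - 1 (x) pi') + pi'. Iterating it from pi' yields an increasing
   sequence, which lies in the cone (no differences of measures are formed) and
   whose masses increase to 1. Its limit Pi satisfies F Pi >= Pi; as both have
   mass 1, Pi K = Pi. A K-invariant probability is a fixed point of F, hence
   dominates the sequence and its limit Pi, hence equals Pi. Since R and P
   commute, Pi R and then Pi P are K-invariant probabilities, so Pi P = Pi. *)
Require Import Defs.
From HB Require Import structures.
From mathcomp Require Import all_boot all_order all_algebra.
From mathcomp Require Import all_classical all_reals all_analysis.
From mathcomp Require Import measurable_realfun.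
From mathcomp Require Import ring lra.

Set Implicit Arguments.
Unset Strict Implicit.
Unset Printing Implicit Defensive.
Import Order.TTheory GRing.Theory Num.Theory.
Import numFieldNormedType.Exports.

Local Open Scope classical_set_scope.
Local Open Scope ring_scope.
Local Open Scope ereal_scope.

(** * Finite sums and increasing limits of measures *)

Section measure_add_finite.
Context d (T : measurableType d) (R : realType).
Variables m1 m2 : {finite_measure set T -> \bar R}.

Let measure_add_fin : fin_num_fun (measure_add m1 m2).
Proof.
by move=> A mA; rewrite measure_addE fin_numD; apply/andP; split;
  exact: fin_num_measure.
Qed.

HB.instance Definition _ := Measure.copy (measure_add m1 m2)
  (msum (fun n => if n is 0%N then m1 : {measure set T -> \bar R} else m2) 2).
HB.instance Definition _ :=
  @Measure_isFinite.Build _ T R (measure_add m1 m2) measure_add_fin.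

End measure_add_finite.

Section measure_sup.
Context d (T : measurableType d) (R : realType).
Variable m : nat -> {measure set T -> \bar R}.

Hypothesis m_nd : forall n A, measurable A -> m n A <= m n.+1 A.

(* The monotonicity proof is an argument only so that the measure structure can
   be inferred from the head constant. *)
Definition measure_sup of (forall n A, measurable A -> m n A <= m n.+1 A) :=
  fun A : set T => ereal_sup (range (m ^~ A)).

Lemma le_measures_seq A : measurable A ->
  {homo m ^~ A : i j / (i <= j)%N >-> i <= j}.
Proof. by move=> mA; apply/nondecreasing_seqP => n; exact: m_nd. Qed.

Lemma cvg_measure_sup A : measurable A ->
  (fun n => m n A) @ \oo --> measure_sup m_nd A.
Proof.
by move=> mA; apply: ereal_nondecreasing_cvgn; exact: le_measures_seq.
Qed.

Lemma measure_sup0 : measure_sup m_nd set0 = 0.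
Proof.
have := cvg_measure_sup measurable0.
rewrite (_ : (fun n => _) = cst 0); last by apply/funext => n; rewrite measure0.
by move=> /cvg_lim <-//; rewrite lim_cst.
Qed.

Lemma measure_sup_ge0 A : 0 <= measure_sup m_nd A.
Proof. by apply: le_trans (ereal_sup_ubound _); last by exists 0%N. Qed.

(** Writing the series as an integral against [counting] turns the exchange of the limit with the
    sum into monotone convergence. *)
Lemma measure_sup_semi_sigma_additive : semi_sigma_additive (measure_sup m_nd).
Proof.
move=> F mF tF mUF; apply/cvg_closeP; split.
  by apply: is_cvg_nneseries => n _ _; exact: measure_sup_ge0.
rewrite closeE//.
transitivity (\int[counting]_n limn (fun k => m k (F n))).
  rewrite ge0_integral_count; last first.
    move=> n; apply: lime_ge; last exact: nearW.
    by apply/cvg_ex; exists (measure_sup m_nd (F n)); exact: cvg_measure_sup.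
  apply: eq_eseriesr => n _.
  by apply/esym/cvg_lim => //; exact: cvg_measure_sup.
rewrite monotone_convergence//; last first.
  by move=> n _; exact: le_measures_seq.
apply/cvg_lim => //.
rewrite (_ : (fun n => _) = (fun n => m n (\bigcup_n F n))).
  exact: cvg_measure_sup.
apply/funext => n; rewrite ge0_integral_count//.
by apply/cvg_lim => //; exact: measure_semi_sigma_additive.
Qed.

HB.instance Definition _ := isMeasure.Build _ _ _ (measure_sup m_nd)
  measure_sup0 measure_sup_ge0 measure_sup_semi_sigma_additive.

End measure_sup.

(** * Integration against the image of a measure under a kernel *)

Section integral_kact.
Context d (T : measurableType d) (R : realType).
Variable P : R.-pker T ~> T.

Lemma measurable_integral_kernel (f : T -> \bar R) :
  (forall x, 0 <= f x) -> measurable_fun [set: T] f ->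
  measurable_fun [set: T] (fun x => \int[P x]_y f y).
Proof.
by move=> f0 mf; apply: measurable_fun_integral_kernel => // U mU;
  exact: measurable_kernel.
Qed.

Variables mu nu : {measure set T -> \bar R}.
Hypothesis numuP : forall A, measurable A -> nu A = \int[mu]_x P x A.

Import HBNNSimple.

Let integral_nnsfun (f : {nnsfun T >-> R}) :
  \int[nu]_z (f z)%:E = \int[mu]_x (\int[P x]_z (f z)%:E).
Proof.
have fsumint (m : {measure set T -> \bar R}) :
    \int[m]_z (f z)%:E = \sum_(r \in range f) r%:E * m (f @^-1` [set r]).
  by rewrite integralT_nnsfun sintegralE.
rewrite fsumint.
under [RHS]eq_integral do rewrite fsumint.
rewrite ge0_integral_fsum//.
- apply: eq_fsbigr => r; rewrite inE/= => -[x _ <-].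
  rewrite ge0_integralZl//.
  + by rewrite numuP.
  + exact: measurable_kernel.
  + by rewrite lee_fin.
- by move=> r; apply: measurable_funeM; exact: measurable_kernel.
(* Here [r] ranges over all reals; for [r] negative the level set is empty and the product is 0. *)
- move=> r x _; have := mulemu_ge0 (fun r => f @^-1` [set r]).
  by apply; exact: preimage_nnfun0.
Qed.

(** The identity holds for simple functions by linearity. Monotone convergence extends it, and is
    used three times: for [nu], for each [P x], and for the outer integral over [mu]. *)
Lemma integral_bind (f : T -> \bar R) :
  (forall x, 0 <= f x) -> measurable_fun [set: T] f ->
  \int[nu]_z f z = \int[mu]_x (\int[P x]_z f z).
Proof.
move=> f0 mf; pose f_ := nnsfun_approx measurableT mf.
have f_0 n z : 0 <= (f_ n z)%:E by rewrite lee_fin.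
have f_m n : measurable_fun [set: T] (fun z => (f_ n z)%:E).
  exact/measurable_EFinP.
have f_nd z : {homo (fun n => (f_ n z)%:E) : n m / (n <= m)%N >-> n <= m}.
  by move=> a b ab; rewrite lee_fin; exact/lefP/nd_nnsfun_approx.
have fE (m : {measure set T -> \bar R}) :
    \int[m]_z f z = limn (fun n => \int[m]_z (f_ n z)%:E).
  rewrite -monotone_convergence//.
  apply/eq_integral => z _.
  by apply/esym/cvg_lim => //=; exact: cvg_nnsfun_approx.
rewrite fE; under eq_fun do rewrite integral_nnsfun.
under [RHS]eq_integral do rewrite fE.
rewrite -monotone_convergence//.
- by move=> n; exact: measurable_integral_kernel.
- by move=> n x _; exact: integral_ge0.
- by move=> x _ a b ab; apply: ge0_le_integral => // z _; exact: f_nd.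
Qed.

End integral_kact.

(** * Composition of Markov kernels and its action on measures *)

Section kernel_composition.
Context d (T : measurableType d) (R : realType).

Lemma kcomp_noparam_setT (P Q : R.-pker T ~> T) x :
  mkcomp_noparam P Q x [set: T] = 1.
Proof.
transitivity (\int[P x]_(y in [set: T]) (cst 1 y : \bar R)).
  by apply: eq_integral => y _; rewrite prob_kernel.
by rewrite integral_cst// mul1e prob_kernel.
Qed.

HB.instance Definition _ (P Q : R.-pker T ~> T) :=
  isProbabilityKernel.Build _ _ _ _ _ (mkcomp_noparam P Q)
    (kcomp_noparam_setT P Q).

Lemma kact_kcomp (mu : {finite_measure set T -> \bar R}) (P Q : R.-pker T ~> T)
    A : measurable A ->
  kact mu (mkcomp_noparam P Q) A = kact (kact mu P) Q A.
Proof.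
move=> mA; apply/esym; apply: (@integral_bind _ _ _ P) => //.
exact: measurable_kernel.
Qed.

Lemma kact_kdirac (mu : {finite_measure set T -> \bar R}) A : measurable A ->
  kact mu (kdirac (@measurable_id _ T [set: T])) A = mu A.
Proof. by move=> mA; rewrite /kact/= /kdirac/dirac integral_indic// setIT. Qed.

Lemma kact_setT (mu : {finite_measure set T -> \bar R}) (P : R.-pker T ~> T) :
  kact mu P [set: T] = mu [set: T].
Proof.
transitivity (\int[mu]_(x in [set: T]) (cst 1 x : \bar R)).
  by apply: eq_integral => x _; rewrite prob_kernel.
by rewrite integral_cst// mul1e.
Qed.

Lemma eq_kact (mu nu : {finite_measure set T -> \bar R}) (P : R.-pker T ~> T) :
  (forall A, measurable A -> mu A = nu A) ->
  forall A, kact mu P A = kact nu P A.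
Proof. by move=> munu A; apply: eq_measure_integral => B mB _; exact: munu. Qed.

End kernel_composition.

(** * Powers and resolvent as Markov kernels *)

Section kernel_resolvent.
Context d (T : measurableType d) (R : realType).
Variable P : R.-pker T ~> T.

(** The recursion of [kiter] at the level of kernels, so that measurability and total mass 1 come
    with the type. *)
Fixpoint kpow (k : nat) : R.-pker T ~> T :=
  if k is k'.+1 then mkcomp_noparam P (kpow k')
  else kdirac (@measurable_id _ T [set: T]).

Lemma kpowE k x A : kpow k x A = kiter P k x A.
Proof.
by elim: k x => [//|k IHk] x /=; apply: eq_integral => y _; exact: IHk.
Qed.

(** The recursion puts the extra factor [P] first; associativity moves it last. This is what makes
    [P] commute with its resolvent. *)
Lemma kpowS k x A : measurable A ->
  \int[kpow k x]_y P y A = kpow k.+1 x A.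
Proof.
move=> mA; have mPA : measurable_fun [set: T] (P ^~ A).
  exact: measurable_kernel.
elim: k x => [|k IHk] x.
  rewrite [LHS]integral_dirac// diracT mul1e.
  rewrite [RHS]/= /mkcomp_noparam /kcomp_noparam/= /kdirac/dirac.
  by rewrite integral_indic// setIT.
rewrite (@integral_bind _ _ _ (kpow k) (P x))//.
by apply: eq_integral => y _; exact: IHk.
Qed.

Section resolvent_kernel.
Variables (a : R) (a01 : (0 < a < 1)%R).

Let a_ge0 : (0 <= a)%R. Proof. by case/andP : a01 => /ltW. Qed.

Let onem_a_ge0 : (0 <= 1 - a)%R.
Proof. by rewrite subr_ge0; case/andP : a01 => _ /ltW. Qed.

Let an_ge0 n : (0 <= a ^+ n)%R. Proof. exact: exprn_ge0. Qed.

Definition kresolvent (x : T) : {measure set T -> \bar R} :=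
  mscale (NngNum onem_a_ge0)
    (mseries (fun k => mscale (NngNum (an_ge0 k)) (kpow k x)) 0).

Lemma kresolventE x A : kresolvent x A = resolvent P a x A.
Proof.
rewrite /kresolvent /= /mscale /= /mseries /resolvent; congr (_ * _).
by apply: eq_eseriesr => k _; rewrite /mscale /= -kpowE.
Qed.

Let kterm_ge0 k x A : 0 <= (a ^+ k)%:E * kpow k x A.
Proof. by rewrite mule_ge0// lee_fin. Qed.

Let measurable_kterm k A : measurable A ->
  measurable_fun [set: T] (fun x => (a ^+ k)%:E * kpow k x A).
Proof. by move=> mA; apply: measurable_funeM; exact: measurable_kernel. Qed.

Lemma measurable_kresolvent A : measurable A ->
  measurable_fun [set: T] (kresolvent ^~ A).
Proof.
move=> mA; apply: measurable_funeM; apply: ge0_emeasurable_sum => // k _.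
exact: measurable_kterm.
Qed.

HB.instance Definition _ :=
  isKernel.Build _ _ _ _ _ kresolvent measurable_kresolvent.

Lemma geometric_weights_sum : (1 - a)%:E * \sum_(0 <= k <oo) (a ^+ k)%:E = 1.
Proof.
have /andP[a0 a1] := a01.
rewrite (_ : \sum_(0 <= k <oo) _ = ((1 - a)^-1)%:E); last first.
  apply/cvg_lim => //.
  rewrite (_ : (fun n => _) = EFin \o series (geometric 1 a)); last first.
    apply/funext => n /=; rewrite /series/= sumEFin; congr EFin.
    by apply: eq_bigr => k _; rewrite mul1r.
  apply/cvg_EFin; first exact: nearW.
  have := @cvg_geometric_series R 1 a; rewrite mul1r; apply.
  by rewrite ger0_norm// ltW.
by rewrite -EFinM mulfV// subr_eq0 gt_eqF.
Qed.

Lemma kresolvent_setT x : kresolvent x [set: T] = 1.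
Proof.
rewrite -geometric_weights_sum; congr (_ * _); apply: eq_eseriesr => k _.
by rewrite -[RHS]mule1 -(prob_kernel (s := kpow k) x).
Qed.

HB.instance Definition _ :=
  Kernel_isProbability.Build _ _ _ _ _ kresolvent kresolvent_setT.

Lemma kact_kresolvent (mu : {finite_measure set T -> \bar R}) A :
  measurable A ->
  kact mu kresolvent A =
  (1 - a)%:E * \sum_(0 <= k <oo) (a ^+ k)%:E * kact mu (kpow k) A.
Proof.
move=> mA; rewrite /kact/= ge0_integralZl//.
- congr (_ * _); rewrite integral_nneseries//.
  + by apply: eq_eseriesr => k _; rewrite ge0_integralZl// ?lee_fin//;
      exact: measurable_kernel.
  + by move=> k; exact: measurable_kterm.
- by apply: ge0_emeasurable_sum => // k _; exact: measurable_kterm.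
Qed.

(** Under the integral over [mu], both sides expand into the same series with terms [a ^+ k] times
    [kpow k.+1 x A]: on the left by [kpowS], on the right by definition of [kpow]. *)
Lemma kact_kresolventC (mu : {finite_measure set T -> \bar R}) A :
  measurable A ->
  kact (kact mu kresolvent) P A = kact (kact mu P) kresolvent A.
Proof.
move=> mA; have mPA : measurable_fun [set: T] (P ^~ A).
  exact: measurable_kernel.
have mRA : measurable_fun [set: T] (kresolvent ^~ A).
  exact: measurable_kernel.
rewrite [LHS](@integral_bind _ _ _ kresolvent mu)//.
rewrite [RHS](@integral_bind _ _ _ P mu)//.
apply: eq_integral => x _.
rewrite ge0_integral_mscale// ge0_integral_measure_series//=.
rewrite ge0_integralZl//; last first.
  by apply: ge0_emeasurable_sum => // k _; exact: measurable_kterm.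
congr (_ * _); rewrite integral_nneseries//; last first.
  by move=> k; exact: measurable_kterm.
apply: eq_eseriesr => k _.
rewrite ge0_integral_mscale// kpowS//.
by rewrite [RHS]ge0_integralZl// ?lee_fin//; exact: measurable_kernel.
Qed.

(** Each power of [P] fixes [mu], and the resolvent averages these powers with weights of sum 1. *)
Lemma invariant_measure_kresolvent (mu : {finite_measure set T -> \bar R}) :
  invariant_measure P mu -> invariant_measure kresolvent mu.
Proof.
move=> muP A mA; rewrite [LHS]kact_kresolvent//.
have muPk k : kact mu (kpow k) A = mu A.
  elim: k => [|k IHk]; first exact: kact_kdirac.
  by rewrite [LHS]kact_kcomp// (eq_kact _ muP).
under eq_eseriesr do rewrite muPk muleC.
have muf : mu A \is a fin_num by exact: fin_num_measure.
rewrite -(fineK muf) nneseriesZl; last by move=> k _; rewrite lee_fin.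
by rewrite muleCA geometric_weights_sum mule1.
Qed.

End resolvent_kernel.
End kernel_resolvent.

(** The reverse inequality on [A] is the given one on the complement of [A], subtracted from the
    common finite mass. *)
Lemma eq_measure_le_setT d (T : measurableType d) (R : realType)
    (mu nu : {finite_measure set T -> \bar R}) :
  (forall A, measurable A -> mu A <= nu A) -> mu [set: T] = nu [set: T] ->
  forall A, measurable A -> mu A = nu A.
Proof.
move=> munu muT A mA; apply/eqP; rewrite eq_le munu//=.
have split (m : {finite_measure set T -> \bar R}) :
    m A = m [set: T] - m (~` A).
  rewrite -(setvU A) measureU//; first 1 last.
  - exact: measurableC.
  - by rewrite setICl.
  - by rewrite addeAC subee ?add0e// fin_num_measure//; exact: measurableC.
rewrite split [leRHS]split muT leeB//.
by apply: munu; exact: measurableC.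
Qed.

(** * Invariant probability of a kernel under a global Doeblin condition; [pi] is here the rescaled
    minorizing measure *)

Section doeblin.
Context d (T : measurableType d) (R : realType).
Variables (K : R.-pker T ~> T) (pi : {finite_measure set T -> \bar R}).

(* On measures of mass at most 1 this is mu |-> mu Q + pi, where
   Q x A = K x A - pi A >= 0; the absolute value only serves to get a
   nonnegative scalar for every mu. *)
Definition regeneration (mu : {finite_measure set T -> \bar R}) :
    {finite_measure set T -> \bar R} :=
  measure_add (kact mu K) (mscale (`|1 - fine (mu [set: T])|%:nng)%R pi).

Definition doeblin_seq (n : nat) : {finite_measure set T -> \bar R} :=
  iter n regeneration pi.

Hypothesis piK : forall x A, measurable A -> pi A <= K x A.

Let fin_pi A : measurable A -> pi A \is a fin_num.
Proof. exact: fin_num_measure. Qed.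

Let mK A : measurable A -> measurable_fun [set: T] (K ^~ A).
Proof. exact: measurable_kernel. Qed.

Let pi_le1 : pi [set: T] <= 1.
Proof. by rewrite -(prob_kernel (s := K) point) piK. Qed.

Lemma regenerationE (mu : {finite_measure set T -> \bar R}) A :
  mu [set: T] <= 1 ->
  regeneration mu A = kact mu K A + (1 - mu [set: T]) * pi A.
Proof.
move=> mu1; rewrite [LHS]measure_addE [X in _ + X]/= /mscale/=.
congr (_ + _ * _).
have muf : mu [set: T] \is a fin_num by exact: fin_num_measure.
by rewrite ger0_norm ?subr_ge0 -?lee_fin ?fineK// EFinB fineK.
Qed.

Lemma regeneration_mass1 (mu : {finite_measure set T -> \bar R}) A :
  mu [set: T] = 1 -> regeneration mu A = kact mu K A.
Proof. by move=> mu1; rewrite regenerationE mu1// subee// mul0e adde0. Qed.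

(** The terms in the mass of [mu] cancel. What remains depends on [mu] only through the integral of
    a nonnegative function, whence monotonicity in [mu]. *)
Lemma regeneration_minus (mu : {finite_measure set T -> \bar R}) A :
  measurable A -> mu [set: T] <= 1 ->
  regeneration mu A = \int[mu]_x (K x A - pi A) + pi A.
Proof.
move=> mA mu1; rewrite regenerationE//.
have muf : mu [set: T] \is a fin_num by exact: fin_num_measure.
have piA := fin_pi mA.
have mB : measurable_fun [set: T] (fun x => K x A - pi A).
  by apply: emeasurable_funB => //; exact: mK.
rewrite (_ : kact mu K A =
    \int[mu]_x (K x A - pi A) + pi A * mu [set: T]); last first.
  rewrite -integral_cst// -ge0_integralD//.
  - by apply: eq_integral => x _; rewrite subeK.
  - by move=> x _; rewrite sube_ge0 ?piK ?fin_pi.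
rewrite -addeA; congr (_ + _).
rewrite -(fineK piA) -(fineK muf) -EFinB -!EFinM -EFinD; congr EFin; ring.
Qed.

Lemma le_regeneration (mu nu : {finite_measure set T -> \bar R}) A :
  (forall B, measurable B -> mu B <= nu B) -> nu [set: T] <= 1 ->
  measurable A ->
  regeneration mu A <= regeneration nu A.
Proof.
move=> munu nu1 mA; rewrite !regeneration_minus//; last first.
  exact: le_trans (munu _ measurableT) nu1.
apply: leeD => //; apply: ge0_le_measure_integral => //.
- by move=> x; rewrite sube_ge0 ?piK ?fin_pi.
- by apply: emeasurable_funB => //; exact: mK.
Qed.

Lemma regeneration_setT (mu : {finite_measure set T -> \bar R}) :
  mu [set: T] <= 1 ->
  regeneration mu [set: T] = mu [set: T] + (1 - mu [set: T]) * pi [set: T].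
Proof. by move=> mu1; rewrite regenerationE// kact_setT. Qed.

Lemma doeblin_seq_le1 n : doeblin_seq n [set: T] <= 1.
Proof.
elim: n => [//|n IHn]; rewrite [leLHS]regeneration_setT//.
have muf : doeblin_seq n [set: T] \is a fin_num by exact: fin_num_measure.
rewrite -[leRHS](subeK _ muf) [leRHS]addeC; apply: leeD => //.
by rewrite -[leRHS]mule1; apply: lee_wpmul2l => //; rewrite sube_ge0// muf.
Qed.

Lemma doeblin_seq_nd n A : measurable A ->
  doeblin_seq n A <= doeblin_seq n.+1 A.
Proof.
elim: n A => [|n IHn] A mA.
  rewrite [leRHS]regeneration_minus//; apply: leeDr.
  by apply: integral_ge0 => x _; rewrite sube_ge0 ?piK ?fin_pi.
by apply: le_regeneration => //; exact: (doeblin_seq_le1 n.+1).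
Qed.

Hypothesis pi_neq0 : pi [set: T] != 0.

(** The proof that [pi] is nonzero is carried as an argument so that the probability structure,
    which depends on it, can be inferred. *)
Definition doeblin_measure of pi [set: T] != 0 :=
  measure_sup (m := doeblin_seq) doeblin_seq_nd.

HB.instance Definition _ (h : pi [set: T] != 0) :=
  Measure.on (doeblin_measure h).

Lemma le_doeblin_measure n A : doeblin_seq n A <= doeblin_measure pi_neq0 A.
Proof. by apply: ereal_sup_ubound; exists n. Qed.

(** With [c] the mass of [pi], the masses satisfy [m_(n+1) = m_n + (1 - m_n) c]. Since [m_(n+1)] and
    [m_n] are at most [l], this gives [m_n <= l - (1 - l) c]. Taking the supremum over [n],
    [l <= l - (1 - l) c], which with [c > 0] excludes [l < 1]. *)
Lemma doeblin_measure_setT : doeblin_measure pi_neq0 [set: T] = 1.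
Proof.
set l := doeblin_measure pi_neq0 _.
have l1 : l <= 1 by apply: ge_ereal_sup => _ [n _ <-]; exact: doeblin_seq_le1.
have l0 : 0 <= l by exact: measure_ge0.
have lf : l \is a fin_num by rewrite ge0_fin_numE// (le_lt_trans l1)// ltry.
have pif := fin_pi measurableT.
have : l <= l - (1 - l) * pi [set: T].
  apply: ge_ereal_sup => _ [n _ <-].
  rewrite leeBrDr; last by rewrite fin_numM// fin_numB lf.
  apply: le_trans (le_doeblin_measure n.+1 _).
  rewrite [leRHS]regeneration_setT ?doeblin_seq_le1//; apply: leeD => //.
  apply: lee_wpmul2r => //; apply: leeB => //; exact: le_doeblin_measure.
move: pi_neq0 l1.
rewrite -(fineK lf) -(fineK pif) -(EFinB 1) -EFinM -EFinB !lee_fin eqe.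
move=> cN0 l1 lc.
congr EFin; apply/eqP; rewrite eq_le l1/= leNgt; apply/negP => l1'.
have c1 : (0 < fine (pi [set: T]))%R by rewrite lt_def cN0 fine_ge0.
have : (0 < (1 - fine l) * fine (pi [set: T]))%R by rewrite mulr_gt0// subr_gt0.
lra.
Qed.

HB.instance Definition _ := Measure_isProbability.Build _ _ _
  (doeblin_measure pi_neq0) doeblin_measure_setT.

Lemma doeblin_measure_invariant : invariant_measure K (doeblin_measure pi_neq0).
Proof.
move=> A mA; apply/esym; apply: eq_measure_le_setT => //; last first.
  exact/esym/kact_setT.
move=> B mB; apply: ge_ereal_sup => _ [n _ <-].
(* Each term of the sequence is at most the next one, which is the regeneration of a measure below
   the limit. *)
apply: (@le_trans _ _ (regeneration (doeblin_measure pi_neq0) B)); last first.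
  by rewrite regeneration_mass1//; exact: doeblin_measure_setT.
apply: le_trans (doeblin_seq_nd n mB) _.
apply: le_regeneration => //; last by rewrite [leLHS]doeblin_measure_setT.
by move=> E mE; exact: le_doeblin_measure.
Qed.

Lemma invariant_eq_doeblin_measure (nu : {finite_measure set T -> \bar R}) :
  nu [set: T] = 1 -> invariant_measure K nu ->
  forall A, measurable A -> nu A = doeblin_measure pi_neq0 A.
Proof.
move=> nuT nuK A mA; apply/esym; apply: eq_measure_le_setT => //; last first.
  by rewrite [LHS]doeblin_measure_setT.
have nuE B : measurable B -> regeneration nu B <= nu B.
  by move=> mB; rewrite regeneration_mass1// [leLHS]nuK.
have nu1 : nu [set: T] <= 1 by rewrite nuT.
move=> B mB; apply: ge_ereal_sup => _ [n _ <-].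
(* As [nu] is a fixed point of [regeneration], it suffices to stay below [regeneration nu]: by
   monotonicity in the inductive step, and because [regeneration nu] dominates [pi] in the base
   case. *)
elim: n B mB => [|n IHn] B mB; apply: le_trans (nuE B mB); last first.
  exact: le_regeneration.
rewrite [leRHS]regeneration_minus//; apply: leeDr.
by apply: integral_ge0 => x _; rewrite sube_ge0 ?piK ?fin_pi.
Qed.

End doeblin.

(** * Feller kernels: from accessibility to a uniform lower bound on the resolvent *)

Section feller_kernel.
Context (R : realType) (M : pMetricType R).

Lemma continuous_measurable_borel (f : M -> R) :
  continuous f -> measurable_fun [set: borel M] (f : borel M -> R).
Proof.
move=> /continuousP cf.
apply: (measurability _ (RGenOpens.measurableE R)) => _ [_ [x [y ->] <-]].
by rewrite setTI; apply: sub_sigma_algebra; apply: cf; exact: interval_open.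
Qed.

Lemma mdist_continuous (p : M) : continuous (mdist p : M -> R).
Proof.
move=> x; apply/cvgrPdist_lt => e e0.
have : nbhs x (ball x e) by apply: nbhsx_ballx.
apply: filterS => y; rewrite ballEmdist/= => xye.
rewrite ltr_norml; have := metric_triangle p x y; have := metric_triangle p y x.
rewrite (metric_sym y x); lra.
Qed.

(** A tent function of the distance to [p], supported in a ball inside [V]. *)
Lemma bump_function (p : M) (V : set M) : nbhs p V ->
  exists f : M -> R, [/\ continuous f, forall x, (0 <= f x <= 1)%R,
    f p = 1%R & forall x, (0 < f x)%R -> V x].
Proof.
move=> /nbhs_ballP[r /= r0 rV].
exists (fun x => Num.max 0 (1 - mdist p x / r))%R; split => [x|x||x].
- apply: (@continuous_max _ M); first exact: cst_continuous.
  apply: cvgB; first exact: cvg_cst.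
  by apply: cvgMr_tmp; exact: mdist_continuous.
- rewrite le_max lexx/= ge_max ler01/= gerBl.
  by rewrite divr_ge0// ?mdist_ge0// ltW.
- by rewrite mdistxx mul0r subr0; apply/max_idPr.
- rewrite lt_max ltxx/= subr_gt0 ltr_pdivrMr// mul1r => xr.
  by apply: rV; rewrite ballEmdist.
Qed.

Variable P : R.-pker (borel M) ~> (borel M).

(** Iterates of [P] on functions, with the real-valued integral for which [feller] is stated. *)
Fixpoint fpow (k : nat) (f : M -> R) (x : M) : R :=
  if k is k'.+1 then (\int[P x]_y fpow k' f y)%R else f x.

Lemma fpow_continuous k (f : M -> R) : feller P -> continuous f ->
  continuous (fpow k f).
Proof. by move=> fP cf; elim: k => [//|k IHk]; exact: fP. Qed.

Lemma fpow_bounds k (f : M -> R) (c : R) (U U' : set (borel M)) :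
  feller P -> continuous f ->
  (0 <= c)%R -> measurable U -> measurable U' ->
  (forall x, (c * \1_U' x <= f x <= \1_U x)%R) ->
  forall x, c%:E * kpow P k x U' <= (fpow k f x)%:E <= kpow P k x U.
Proof.
move=> fP cf c0 mU mU' fU; elim: k => [|k IHk] x.
  by rewrite /= /kdirac/= /dirac/= -EFinM !lee_fin.
have ck : continuous (fpow k f) by exact: fpow_continuous.
have mk : measurable_fun [set: borel M] (EFin \o fpow k f : borel M -> \bar R).
  by apply/measurable_EFinP; exact: continuous_measurable_borel.
have f0 y : 0 <= (fpow k f y)%:E.
  by have /andP[+ _] := IHk y; apply: le_trans; rewrite mule_ge0// lee_fin.
have leU : \int[P x]_y (fpow k f y)%:E <= kpow P k.+1 x U.
  apply: ge0_le_integral => //; first exact: measurable_kernel.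
  by move=> y _; have /andP[] := IHk y.
(* The real integral is [fine] of the extended one; finiteness lets the two be identified. *)
have fin : \int[P x]_y (fpow k f y)%:E \is a fin_num.
  rewrite ge0_fin_numE; last exact: integral_ge0.
  apply: (le_lt_trans leU); apply: (@le_lt_trans _ _ 1); last by rewrite ltry.
  rewrite -(prob_kernel (s := kpow P k.+1) x).
  by apply: le_measure; rewrite ?inE.
rewrite [(fpow k.+1 f x)%:E]fineK// leU andbT.
rewrite [kpow P k.+1 x U']/= -ge0_integralZl//; last first.
  exact: measurable_kernel.
apply: ge0_le_integral => //.
- by move=> y _; rewrite mule_ge0// lee_fin.
- by apply: measurable_funeM; exact: measurable_kernel.
- by move=> y _; have /andP[] := IHk y.
Qed.

Lemma resolvent_gt0 a x U : (0 < a < 1)%R -> 0 < resolvent P a x U ->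
  exists k, 0 < kiter P k x U.
Proof.
move=> /andP[a0 a1] RU; apply: contrapT => /forallNP k0.
move: RU; rewrite /resolvent eseries0 ?mule0 ?ltxx// => k _ _.
have : kiter P k x U <= 0 by rewrite leNgt; apply/negP; exact: k0.
rewrite -kpowE => kU0; suff -> : kpow P k x U = 0 by rewrite mule0.
by apply/eqP; rewrite eq_le kU0/=.
Qed.

Lemma kiter_le_resolvent a k x U : (0 < a < 1)%R ->
  ((1 - a) * a ^+ k)%:E * kiter P k x U <= resolvent P a x U.
Proof.
move=> /andP[a0 a1]; rewrite /resolvent EFinM -muleA; apply: lee_wpmul2l.
  by rewrite lee_fin subr_ge0 ltW.
have h0 n : 0 <= (a ^+ n)%:E * kiter P n x U.
  by rewrite -kpowE mule_ge0// lee_fin exprn_ge0// ltW.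
apply: le_trans (nneseries_lim_ge k.+1 _); last by [].
by rewrite big_nat_recr//= leeDr// sume_ge0.
Qed.

(** The functions [g k], weighted iterates of a bump function at [p], are continuous, and
    accessibility makes one of them positive at each point. Compactness gives a common positive
    lower bound [e], and each [g k] is at most the resolvent of [U]. *)
Lemma accessible_resolvent_minoration (p : M) (V : set M) (a : R) :
  compact [set: M] -> feller P -> accessible P p -> nbhs p V -> (0 < a < 1)%R ->
  exists U : set (borel M), exists delta : R,
    [/\ measurable U, U `<=` V, (0 < delta)%R &
        forall x, delta%:E <= resolvent P a x U].
Proof.
move=> cM fP accp pV a01; have /andP[a0 a1] := a01.
have [f [cf f01 fp1 fV]] := bump_function pV.
have mf := continuous_measurable_borel cf.
have mgt (c : R) : measurable ([set x | (c < f x)%R] : set (borel M)).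
  rewrite -[X in measurable X]setTI.
  rewrite (_ : [set x | _] = f @^-1` `]c, +oo[%classic).
    exact: mf.
  by apply/seteqP; split => x/=; rewrite in_itv/= andbT.
(* [U] is a Borel substitute for [V]. On the smaller neighbourhood [U'] the function [f] is at least
   1/2, so positive probability of reaching [U'] makes an iterate of [f] positive. *)
pose U : set (borel M) := [set x | (0 < f x)%R].
pose U' : set (borel M) := [set x | (2^-1 < f x)%R].
have pU' : nbhs p (U' : set M).
  have : f x @[x --> p] --> f p by exact: cf.
  by move=> /cvgr_gt; apply; rewrite fp1; lra.
have fU x : (2^-1 * \1_U' x <= f x <= \1_U x)%R.
  have /andP[f0 f1] := f01 x; rewrite !indicE.
  apply/andP; split.
    case: (boolP (x \in U')) => [|_]; last by rewrite mulr0.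
    by rewrite inE mulr1 => /ltW.
  case: (boolP (x \in U)) => //; rewrite notin_setE => /negP.
  by rewrite -leNgt.
have bnd k x : (2^-1)%:E * kpow P k x U' <= (fpow k f x)%:E <= kpow P k x U.
  by apply: fpow_bounds => //; exact: mgt.
pose g k x : R := ((1 - a) * a ^+ k * fpow k f x)%R.
have cover : \forall e \near (0:R)^'+,
    [set: M] `<=` (fun x => exists k, (e < g k x)%R).
  apply: (compact_near_coveringP _).1 => // x _.
  (* The parameter [b] depends on [x] and may differ from [a]; only the positivity of some iterate
     is retained. *)
  have [b [b01 Rb]] := accp U' pU' (mgt _) x.
  have [k kx] := resolvent_gt0 b01 Rb.
  have gx : (0 < g k x)%R.
    rewrite mulr_gt0 ?mulr_gt0 ?exprn_gt0 ?subr_gt0// -lte_fin.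
    have /andP[+ _] := bnd k x; apply: lt_le_trans.
    by rewrite mule_gt0 ?lte_fin// kpowE.
  near=> x' e => /=; exists k.
  apply: (@lt_trans _ _ (g k x / 2)%R).
    near: e; apply: nbhs_right_lt; rewrite divr_gt0//.
  near: x'.
  have : g k y @[y --> x] --> g k x.
    by apply: cvgMl_tmp; exact: fpow_continuous.
  by move=> /cvgr_gt; apply; lra.
have [e e0 eg] : exists2 e : R, (0 < e)%R & forall x, exists k, (e < g k x)%R.
  near (0:R)^'+ => e; exists e; first by near: e; exact: nbhs_right_gt.
  have : [set: M] `<=` (fun x => exists k, (e < g k x)%R) by near: e.
  by move=> eg x; exact: eg.
exists U, e; split => //; [exact: mgt|move=> x].
have [k egk] := eg x; apply: le_trans (kiter_le_resolvent k x U a01).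
rewrite -kpowE; have /andP[_ fk] := bnd k x.
apply: (@le_trans _ _ (g k x)%:E); first by rewrite lee_fin ltW.
rewrite /g EFinM; apply: lee_wpmul2l => //.
by rewrite lee_fin mulr_ge0 ?exprn_ge0 ?subr_ge0 ?ltW.
Unshelve. all: by end_near. Qed.

End feller_kernel.

(** * Closure properties of the cone *)

Section invariant_cone.
Context (R : realType) (M : pMetricType R).
Variable C : set {finite_measure set (borel M) -> \bar R}.
Hypotheses (coneC : convex_cone C) (monoC : stable_monotone_convergence C).
Implicit Types (mu nu : {finite_measure set (borel M) -> \bar R}).

Lemma cone_eq mu nu : C mu -> (forall A, measurable A -> nu A = mu A) -> C nu.
Proof.
move=> Cmu numu; apply: (coneC Cmu Cmu (a := 1%R) (b := 0%R)) => // A mA.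
by rewrite mul1e mul0e adde0 numu.
Qed.

Lemma cone_add mu nu : C mu -> C nu -> C (measure_add mu nu).
Proof.
move=> Cmu Cnu; apply: (coneC Cmu Cnu (a := 1%R) (b := 1%R)) => // A mA.
by rewrite !mul1e [LHS]measure_addE.
Qed.

Lemma cone_scale mu (r : {nonneg R}) : C mu -> C (mscale r mu).
Proof.
move=> Cmu; apply: (coneC Cmu Cmu (a := r%:num%R) (b := 0%R)) => // A mA.
by rewrite mul0e adde0.
Qed.

Lemma cone_kpow (P : R.-pker (borel M) ~> (borel M)) k mu :
  (forall nu, C nu -> C (kact nu P)) -> C mu -> C (kact mu (kpow P k)).
Proof.
move=> CP; elim: k mu => [|k IHk] mu Cmu.
  by apply: (cone_eq Cmu) => A mA; exact: kact_kdirac.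
by apply: (cone_eq (IHk _ (CP _ Cmu))) => A mA; exact: kact_kcomp.
Qed.

(** The partial sums of the resolvent series are in the cone and increase setwise to a finite
    measure. *)
Lemma cone_kresolvent (P : R.-pker (borel M) ~> (borel M)) (a : R)
    (a01 : (0 < a < 1)%R) mu :
  (forall nu, C nu -> C (kact nu P)) -> C mu -> C (kact mu (kresolvent P a01)).
Proof.
move=> CP Cmu; have /andP[a0 a1] := a01.
have an0 k : (0 <= (1 - a) * a ^+ k)%R.
  by rewrite mulr_ge0 ?exprn_ge0 ?subr_ge0 ?ltW.
pose term k : {finite_measure set (borel M) -> \bar R} :=
  mscale (NngNum (an0 k)) (kact mu (kpow P k)).
(* The empty sum is written as 0 times [mu], so that it lies in the cone by scaling. *)
pose psum := fix psum n : {finite_measure set (borel M) -> \bar R} :=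
  if n is n'.+1 then measure_add (psum n') (term n')
  else mscale (NngNum (lexx (0 : R)%R)) mu.
have psumS n A : psum n.+1 A = psum n A + term n A by exact: measure_addE.
have psumE n A : psum n A = \sum_(0 <= k < n) term k A.
  elim: n => [|n IHn]; first by rewrite big_nil /= /mscale/= mul0e.
  by rewrite big_nat_recr// -IHn psumS.
apply: (monoC (mu_ := psum)) => [n|n A mA|A mA].
- elim: n => [|n IHn]; first exact: cone_scale.
  by apply: cone_add => //; apply: cone_scale; exact: cone_kpow.
- by rewrite psumS leeDl.
- rewrite (_ : (fun n => _) =
    (fun n => \sum_(0 <= k < n) term k A)); last first.
    by apply/funext.
  have termE : \sum_(0 <= k <oo) term k A = kact mu (kresolvent P a01) A.
    rewrite kact_kresolvent// -nneseriesZl//; last first.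
      by move=> k _; rewrite mule_ge0// lee_fin exprn_ge0// ltW.
    by apply: eq_eseriesr => k _; rewrite muleA -EFinM.
  have : (fun n => \sum_(0 <= k < n) term k A) @ \oo -->
      \sum_(0 <= k <oo) term k A.
    by apply: is_cvg_nneseries => k _ _; exact: measure_ge0.
  by rewrite termE.
Qed.

Lemma cone_doeblin_seq (K : R.-pker (borel M) ~> (borel M)) pi n :
  (forall nu, C nu -> C (kact nu K)) -> C pi -> C (doeblin_seq K pi n).
Proof.
move=> CK Cpi; elim: n => [//|n IHn].
by apply: cone_add; [exact: CK|exact: cone_scale].
Qed.

End invariant_cone.

Theorem theorem2p11 (R : realType) (M : pMetricType R)
    (P : R.-pker (borel M) ~> (borel M))
    (C : set {finite_measure set (borel M) -> \bar R})
    (p : M) (pi : {finite_measure set (borel M) -> \bar R})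
    (compactM : compact [set: M])
    (fellerP : feller P)
    (coneC : convex_cone C)
    (monoC : stable_monotone_convergence C)
    (CP : forall mu, C mu -> C (kact mu P))
    (accp : accessible P p)
    (minpi : minorizing_measure P p pi)
    (Cpi : C pi)
    (Cdiff : forall mu : {finite_measure set (borel M) -> \bar R}, C mu ->
      (forall A, measurable A -> pi A <= mu A) ->
      forall nu : {finite_measure set (borel M) -> \bar R},
        (forall A, measurable A -> nu A = mu A - pi A) -> C nu) :
  exists Pi : probability (borel M) R,
    [/\ invariant_measure P Pi,
        (forall Pi' : probability (borel M) R, invariant_measure P Pi' ->
          forall A, measurable A -> Pi' A = Pi A) &
        C Pi].
Proof.
have [pi0 [V [a [pV a01 piR]]]] := minpi.
have [U [delta [mU UV delta0 deltaU]]] :=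
  accessible_resolvent_minoration compactM fellerP accp pV a01.
pose Ra : R.-pker (borel M) ~> (borel M) := kresolvent P a01.
pose K : R.-pker (borel M) ~> (borel M) := mkcomp_noparam Ra Ra.
pose dpi : {finite_measure set (borel M) -> \bar R} :=
  mscale (NngNum (ltW delta0)) pi.
(* Restrict the intermediate point of [K = Ra Ra] to [U]: there [Ra y A >= pi A], and
   [Ra x U >= delta]. *)
have dpiK x A : measurable A -> dpi A <= K x A.
  move=> mA; have mRA : measurable_fun [set: borel M] (Ra ^~ A).
    exact: measurable_kernel.
  apply: (@le_trans _ _ (\int[Ra x]_(y in U) pi A)).
    rewrite integral_cst// muleC; apply: lee_wpmul2r => //.
    by rewrite [leRHS]kresolventE.
  apply: (@le_trans _ _ (\int[Ra x]_(y in U) Ra y A)).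
    apply: ge0_le_integral => //; first exact: measurable_funTS.
    by move=> y /UV Vy; rewrite [leRHS]kresolventE; exact: piR.
  exact: ge0_subset_integral.
have dpi0 : dpi [set: borel M] != 0.
  by rewrite mule_neq0// eqe gt_eqF.
pose Pi : probability (borel M) R := doeblin_measure dpiK dpi0.
have PiK : invariant_measure K Pi by exact: doeblin_measure_invariant.
have uniqK (nu : {finite_measure set (borel M) -> \bar R}) :
    nu [set: borel M] = 1 -> invariant_measure K nu ->
    forall A, measurable A -> nu A = Pi A.
  exact: invariant_eq_doeblin_measure.
have KE (nu : {finite_measure set (borel M) -> \bar R}) A : measurable A ->
    kact nu K A = kact (kact nu Ra) Ra A.
  exact: kact_kcomp.
have Pi_kact1 Q : kact Pi Q [set: borel M] = 1.
  by rewrite kact_setT; exact: doeblin_measure_setT.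
(* [Pi Ra] is [K]-invariant because [(Pi Ra) Ra Ra = (Pi K) Ra = Pi Ra]. *)
have PiRa : invariant_measure Ra Pi.
  apply: uniqK => [|A mA]; first exact: Pi_kact1.
  rewrite KE//; apply: eq_kact => B mB.
  by rewrite -[LHS]KE// [LHS]PiK.
(* By commutation [(Pi P) Ra = (Pi Ra) P = Pi P], so [Pi P] is invariant under [Ra], hence under
   [K]. *)
have PiP : invariant_measure P Pi.
  apply: uniqK => [|A mA]; first exact: Pi_kact1.
  have PiPRa B : measurable B -> kact (kact Pi P) Ra B = kact Pi P B.
    by move=> mB; rewrite -[LHS]kact_kresolventC// (eq_kact _ PiRa).
  by rewrite KE// (eq_kact _ PiPRa) PiPRa.
exists Pi; split => // [nu nuP|].
- apply: uniqK; first exact: probability_setT.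
  have nuRa := invariant_measure_kresolvent a01 nuP.
  by move=> A mA; rewrite KE// (eq_kact _ nuRa) nuRa.
(* [Pi] is by construction the increasing limit of this sequence, whose terms need only sums,
   scalings and the action of [K]. *)
- apply: (@monoC (doeblin_seq K dpi)) => [n|n A mA|A mA].
  + apply: cone_doeblin_seq => // [nu Cnu|]; last exact: cone_scale.
    apply: (cone_eq coneC (mu := kact (kact nu Ra) Ra)) => //.
    - by do 2! apply: cone_kresolvent => //.
    - by move=> A mA; exact: KE.
  + exact: doeblin_seq_nd.
  + exact: cvg_measure_sup.
Qed.
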